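(* Let $T,S\in\mathcal{B}_A(\mathcal{H})$. Then $$\omega_A^2(S^{\sharp_A}T)\le\inf_{\alpha,\beta}\frac{1}{\alpha+\beta}\Big\{\frac{\alpha}{2}\big\|(T^{\sharp_A}T)^2+(S^{\sharp_A}S)^2\big\|_A+\beta\,\|S^{\sharp_A}T\|_A^2\Big\}\le\frac12\big\|(T^{\sharp_A}T)^2+(S^{\sharp_A}S)^2\big\|_A,$$ where the infimum is over all reals $\alpha,\beta\ge0$ with $(\alpha,\beta)\ne(0,0)$.
   Context: $\mathcal{H}$ is a non-trivial complex Hilbert space, $\mathcal{B}(\mathcal{H})$ the bounded linear operators on it, $A\in\mathcal{B}(\mathcal{H})$ a fixed positive operator ($\langle Ax,x\rangle\ge0$ for all $x$). Put $\langle x,y\rangle_A=\langle Ax,y\rangle$ and $\|x\|_A=\langle Ax,x\rangle^{1/2}$. $\mathcal{B}_A(\mathcal{H})$ is the set of $T\in\mathcal{B}(\mathcal{H})$ for which there is $W\in\mathcal{B}(\mathcal{H})$ with $AW=T^*A$ (equivalently, $\mathcal{R}(T^*A)\subseteq\mathcal{R}(A)$); for such $T$, $T^{\sharp_A}=A^\dagger T^*A$ ($A^\dagger$ the Moore–Penrose inverse) is the unique bounded $W$ with $AW=T^*A$ and $\mathcal{R}(W)\subseteq\overline{\mathcal{R}(A)}$. Every $T\in\mathcal{B}_A(\mathcal{H})$ satisfies $\|Tx\|_A\le c\|x\|_A$ for all $x$, for some $c>0$; put $\|T\|_A=\sup_{\|x\|_A=1}\|Tx\|_A$ and $\omega_A(T)=\sup_{\|x\|_A=1}|\langle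 Tx,x\rangle_A|$. *)

(* Defs.v *)
From HB Require Import structures.
From mathcomp Require Import all_boot all_order all_algebra.
From mathcomp Require Import complex.
From mathcomp Require Import all_classical all_reals all_analysis.

Set Implicit Arguments.
Unset Strict Implicit.
Unset Printing Implicit Defensive.

Import Order.TTheory GRing.Theory Num.Theory.
Import numFieldNormedType.Exports.

Local Open Scope classical_set_scope.
Local Open Scope ring_scope.
Local Open Scope complex_scope.

Section SemiHilbert.
Context {R : realType} {H : completeNormedModType R[i]}.
(* linear in the first argument, conjugate-linear in the second *)
Variable dot : {dot H for Num.conj}.

(* A complex Hilbert space is a complex Banach space whose norm comes from an
   inner product; norms and inner products take their values in R[i]. *)
Definition hilbert_norm : Prop := forall x : H, `|x| ^+ 2 = dot x x.

Definition bounded_op (T : {linear H -> H}) : Prop :=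
  exists c : R, forall x : H, `|T x| <= c%:C * `|x|.

(* In R[i], 0 <= z means that z is real and nonnegative. *)
Definition positive_op (A : {linear H -> H}) : Prop :=
  forall x : H, 0 <= dot (A x) x.

(* T^* y is the unique z with <T x, y> = <x, z> for all x; it exists (Riesz)
   when T is bounded. *)
Definition adjoint (T : H -> H) (y : H) : H :=
  xget 0 [set z | forall x : H, dot (T x) y = dot x z].

Definition orthocompl (E : set H) : set H :=
  [set x | forall y, E y -> dot x y = 0].

(* The Moore-Penrose inverse has domain R(A) + R(A)^_|_ (with value 0 off this
   domain, by convention): it inverts the restriction of A to N(A)^_|_ and
   vanishes on R(A)^_|_, i.e. it sends A x + w to x
   for x in N(A)^_|_ and w in R(A)^_|_. *)
Definition mpinv (A : H -> H) (y : H) : H :=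
  xget 0 [set x | orthocompl [set z | A z = 0] x /\
                  orthocompl (range A) (y - A x)].

Section Operator.
Variable A : {linear H -> H}.

Definition dotA (x y : H) : R[i] := dot (A x) y.

(* The complex number <A x, x> is real when A is positive. *)
Definition normA (x : H) : R := Num.sqrt (complex.Re (dotA x x)).

Definition BA (T : {linear H -> H}) : Prop :=
  bounded_op T /\
  exists2 W : {linear H -> H}, bounded_op W &
    forall x : H, A (W x) = adjoint T (A x).

Definition sharpA (T : H -> H) : H -> H := mpinv A \o adjoint T \o A.

(* These suprema are over the empty set, hence 0, when A = 0. *)
Definition opnormA (T : H -> H) : R :=
  sup [set normA (T x) | x in [set x : H | normA x = 1]].

Definition numradA (T : H -> H) : R :=
  sup [set complex.Re `|dotA (T x) x| | x in [set x : H | normA x = 1]].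

End Operator.
End SemiHilbert.

(* Main.v *)
(* For |x|_A = 1, Cauchy-Schwarz gives |<S^# T x, x>_A| <= |S^# T x|_A; since
   also <S^# T x, x>_A = <T x, S x>_A, it gives with the arithmetic-geometric
   mean inequality
     |<T x, S x>_A|^2 <= (<T^# T x, x>_A^2 + <S^# S x, x>_A^2) / 2
                      <= <((T^# T)^2 + (S^# S)^2) x, x>_A / 2.
   Thus omega_A(S^# T)^2 is below two numbers of which every element of the
   infimum is a convex combination; (alpha, beta) = (1, 0) gives the upper bound.
   The operators must be A-bounded, since the supremum of an unbounded set of
   reals is 0 in the library: this is Krein's theorem on symmetrizable operators.
   The adjoint and the Moore-Penrose inverse exist by orthogonal projection onto
   closed subspaces and the Riesz representation theorem. *)
Require Import Defs.
From HB Require Import structures.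
From mathcomp Require Import all_boot all_order all_algebra.
From mathcomp Require Import complex.
From mathcomp Require Import all_classical all_reals all_analysis.
From mathcomp Require Import ring lra.

Set Implicit Arguments.
Unset Strict Implicit.
Unset Printing Implicit Defensive.

Import Order.TTheory GRing.Theory Num.Theory.
Import numFieldNormedType.Exports.

Local Open Scope classical_set_scope.
Local Open Scope ring_scope.
Local Open Scope complex_scope.

(** * Semi-inner products: Cauchy-Schwarz, the triangle inequality, the parallelogram law *)

Section SemiInnerProduct.
Context {R : realType} {V : lmodType R[i]}.
Implicit Types (p : V -> V -> R[i]) (x y z : V).

(** Definiteness is left out so that the notion covers both [dot] and the degenerate form [dotA]. *)
Definition semi_inner p : Prop :=
  [/\ forall a x y z, p (a *: x + y) z = a * p x z + p y z,
      forall x y, p y x = Num.conj (p x y) &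
      forall x, 0 <= p x x].

Definition seminorm p x : R := Num.sqrt (complex.Re (p x x)).

Lemma normcE_Re (z : R[i]) : `|z| = (complex.Re `|z|)%:C.
Proof. by rewrite RRe_real // normr_real. Qed.

Lemma conjC_real (t : R) : Num.conj (t%:C : R[i]) = t%:C.
Proof. by apply/CrealP/complex_realP; exists t. Qed.

Lemma Re_normc_ge0 (z : R[i]) : 0 <= complex.Re `|z|.
Proof. by rewrite -ler0c -normcE_Re. Qed.

Lemma Re_le_normc (z : R[i]) : complex.Re z <= complex.Re `|z|.
Proof.
by rewrite (le_trans (ler_norm _)) // -lecR -normcE_Re normc_ge_Re.
Qed.

Context (p : V -> V -> R[i]) (pP : semi_inner p).
Local Notation N := (seminorm p).

Let pC x y : p y x = Num.conj (p x y). Proof. by case: pP. Qed.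

Lemma si0l z : p 0 z = 0.
Proof.
case: pP => L _ _; apply/eqP.
by have := L 1 0 0 z; rewrite scaler0 addr0 mul1r => /esym/eqP; rewrite -subr_eq0 addrK.
Qed.

Lemma siDl x y z : p (x + y) z = p x z + p y z.
Proof. by case: pP => L _ _; have := L 1 x y z; rewrite scale1r mul1r. Qed.

Lemma siZl a x z : p (a *: x) z = a * p x z.
Proof. by case: pP => L _ _; have := L a x 0 z; rewrite addr0 si0l addr0. Qed.

Lemma siNl x z : p (- x) z = - p x z.
Proof. by rewrite -scaleN1r siZl mulN1r. Qed.

Lemma siDr x y z : p z (x + y) = p z x + p z y.
Proof. by rewrite ![p z _]pC siDl rmorphD. Qed.

Lemma siZr a x z : p z (a *: x) = Num.conj a * p z x.
Proof. by rewrite ![p z _]pC siZl rmorphM. Qed.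

Lemma siNr x z : p z (- x) = - p z x.
Proof. by rewrite ![p z _]pC siNl rmorphN. Qed.

Lemma seminorm_ge0 x : 0 <= N x.
Proof. exact: sqrtr_ge0. Qed.

Lemma siE x : p x x = (N x ^+ 2)%:C.
Proof.
case: pP => _ _ /(_ x) p0; rewrite sqr_sqrtr; last by move: p0; rewrite lecE => /andP[].
by rewrite RRe_real // ger0_real.
Qed.

Lemma seminorm_sqr x : N x ^+ 2 = complex.Re (p x x).
Proof. by rewrite siE. Qed.

(** The factor [p x y] in the shift makes the cross terms real. The parameter t stays free: its
    choice yields both the orthogonality of minimizers and Cauchy-Schwarz. *)
Lemma seminorm_shift (t : R) x y :
  N (x - (t%:C * p x y) *: y) ^+ 2 =
  N x ^+ 2 - 2 * t * complex.Re `|p x y| ^+ 2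
    + t ^+ 2 * complex.Re `|p x y| ^+ 2 * N y ^+ 2.
Proof.
set c := p x y; set k := complex.Re _.
have ck : c * Num.conj c = k%:C * k%:C by rewrite -normCK normcE_Re expr2.
have NE z : (N z)%:C * (N z)%:C = p z z by rewrite siE // expr2 rmorphM.
apply: (@complexI R); rewrite -siE !(rmorphD, rmorphN, rmorphM) /= !NE -ck.
rewrite siDl siNl siZl !siDr !siNr !siZr -/c [p y x]pC -/c rmorphM /= conjC_real.
rewrite (_ : 1%:C = 1) //.
by ring.
Qed.

(** With t = 1 / (N y ^ 2 + 1), well defined even when N y = 0, the shift lowers N x ^ 2 by t (1 +
    t) |p x y| ^ 2, which minimality forces to vanish. *)
Lemma seminorm_min_ortho x y :
  (forall a, N x <= N (x - a *: y)) -> p x y = 0.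
Proof.
move=> xmin; have := seminorm_shift ((N y ^+ 2 + 1)^-1) x y.
set k := complex.Re _; set q := N y ^+ 2.
have q0 : 0 <= q by rewrite sqr_ge0.
set t := _^-1; move=> Ht.
have {Ht} : N x ^+ 2 <= N x ^+ 2 - 2 * t * k ^+ 2 + t ^+ 2 * k ^+ 2 * q.
  by rewrite -Ht ler_sqr ?nnegrE ?seminorm_ge0.
have t0 : 0 < t by rewrite invr_gt0; lra.
have -> : t ^+ 2 * k ^+ 2 * q = t * k ^+ 2 * (t * q) by ring.
have -> : t * q = 1 - t by rewrite /t; field; lra.
rewrite -addrA lerDl => h.
have k2 : k ^+ 2 * (t * (1 + t)) <= 0 by nra.
have {}k2 : k ^+ 2 <= 0 by move: k2; rewrite pmulr_lle0 //; nra.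
have : k = 0 by apply/eqP; rewrite -sqrf_eq0 eq_le k2 sqr_ge0.
by rewrite /k => k0; apply/eqP; rewrite -normr_eq0 normcE_Re k0.
Qed.

Lemma si_CauchySchwarz x y : complex.Re `|p x y| <= N x * N y.
Proof.
rewrite -ler_sqr ?nnegrE ?mulr_ge0 ?seminorm_ge0 ?Re_normc_ge0 // exprMn.
have [y0|/eqP y0] := eqVneq (N y) 0; last first.
  have := seminorm_shift ((N y ^+ 2)^-1) x y.
  set k := complex.Re _ => h.
  have q0 : 0 < N y ^+ 2 by rewrite exprn_even_gt0 //=; apply/eqP.
  have : 0 <= N x ^+ 2 - (N y ^+ 2)^-1 * k ^+ 2.
    apply: le_trans (sqr_ge0 (N (x - ((N y ^+ 2)^-1%:C * p x y) *: y))) _.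
    by rewrite h le_eqVlt; apply/orP; left; apply/eqP; field; exact/eqP.
  by rewrite subr_ge0 mulrC ler_pdivrMr.
rewrite y0 expr0n mulr0; set k := complex.Re _ ^+ 2; rewrite leNgt.
apply/negP => k0.
(* When N y = 0 the shifted square is affine in t; this t would make it equal to -1. *)
set t := (N x ^+ 2 + 1) / (2 * k).
have : 0 <= N x ^+ 2 - 2 * t * k.
  have := seminorm_shift t x y; rewrite y0 -/k expr0n mulr0 addr0 => <-.
  exact: sqr_ge0.
have -> : 2 * t * k = N x ^+ 2 + 1.
  by rewrite /t; field; rewrite gt_eqF.
by lra.
Qed.

Lemma si_unit_le x y : N x = 1 -> complex.Re `|p y x| <= N y.
Proof. by move=> x1; rewrite -[leRHS]mulr1 -x1 si_CauchySchwarz. Qed.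

Lemma Re_si_le x y : complex.Re (p x y) <= N x * N y.
Proof. exact: le_trans (Re_le_normc _) (si_CauchySchwarz x y). Qed.

Lemma seminormD x y : N (x + y) <= N x + N y.
Proof.
rewrite -ler_sqr ?nnegrE ?addr_ge0 ?seminorm_ge0 // seminorm_sqr siDl !siDr.
have hC : complex.Re (p y x) <= N x * N y by rewrite mulrC Re_si_le.
have := Re_si_le x y; rewrite !raddfD /= -!seminorm_sqr; lra.
Qed.

Lemma seminormN x : N (- x) = N x.
Proof. by rewrite /seminorm siNl siNr opprK. Qed.

Lemma seminormBC x y : N (x - y) = N (y - x).
Proof. by rewrite -seminormN opprB. Qed.

Lemma parallelogram x y :
  N (x + y) ^+ 2 + N (x - y) ^+ 2 = 2 * N x ^+ 2 + 2 * N y ^+ 2.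
Proof.
rewrite !seminorm_sqr !siDl !siDr !siNl !siNr !raddfD /= !raddfN /= ?opprK.
by ring.
Qed.

Lemma seminormZ (t : R) x : 0 <= t -> N (t%:C *: x) = t * N x.
Proof.
move=> t0; apply/eqP; rewrite -(@eqrXn2 _ 2) ?mulr_ge0 ?seminorm_ge0 //.
apply/eqP/(@complexI R); rewrite -siE siZl siZr exprMn rmorphM /= -siE.
by rewrite conjC_real mulrA rmorphXn expr2.
Qed.

End SemiInnerProduct.

(** * Adjoint pairs for a semi-inner product, and Krein's boundedness argument *)

Section SemiAdjoint.
Context {R : realType} {V : lmodType R[i]}.
Context (p : V -> V -> R[i]) (pP : semi_inner p).
Local Notation N := (seminorm p).
Implicit Types (T W G : V -> V) (x y : V).

(** A relation rather than a function: for a degenerate form T may have several adjoints. *)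
Definition adjoint_pair T W : Prop := forall x y, p (W x) y = p x (T y).

Lemma adjoint_pairC T W x y : adjoint_pair T W -> p (T x) y = p x (W y).
Proof. by case: pP => _ C _ TW; rewrite C -TW -C. Qed.

(** Cauchy-Schwarz gives N (W x) ^ 2 = p x (T (W x)) <= c N x N (W x); then divide by N (W x). *)
Lemma adjoint_pair_bounded T W c : 0 <= c -> adjoint_pair T W ->
  (forall x, N (T x) <= c * N x) -> forall x, N (W x) <= c * N x.
Proof.
move=> c0 TW Tc x; have [->|Wx0] := eqVneq (N (W x)) 0.
  by rewrite mulr_ge0 // seminorm_ge0.
have Wx : 0 < N (W x) by rewrite lt_def Wx0 seminorm_ge0.
rewrite -(ler_pM2r Wx) -expr2 seminorm_sqr // TW.
apply: le_trans (Re_si_le pP _ _) _; rewrite mulrC -mulrA.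
by rewrite [N x * _]mulrC mulrA ler_wpM2r ?seminorm_ge0.
Qed.

Lemma adjoint_pair_iter G n : adjoint_pair G G -> adjoint_pair (iter n G) (iter n G).
Proof.
move=> GG; elim: n => [//|n IH] x y.
by rewrite iterS GG IH -iterSr.
Qed.

(** If r > 1, Bernoulli's inequality gives r ^ (2 ^ n) >= 1 + 2 ^ n (r - 1), which is unbounded in
    n. *)
Lemma expr_bounded_le1 (r K : R) :
  0 <= r -> (forall n, r ^+ (2 ^ n) <= K) -> r <= 1.
Proof.
move=> r0 rK; rewrite leNgt; apply/negP => r1.
have bern m : 1 + m%:R * (r - 1) <= r ^+ m.
  elim: m => [|m IH]; first by rewrite expr0 mul0r addr0.
  rewrite exprS -natr1.
  have := ler_wpM2l r0 IH; have := mulr_ge0 (ler0n R m) (sqr_ge0 (r - 1)).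
  by lra.
have [n Kn] : exists n : nat, K / (r - 1) < n%:R.
  exists (Num.bound `|K / (r - 1)|).
  exact: le_lt_trans (ler_norm _) (archi_boundP (normr_ge0 _)).
have := rK n; rewrite leNgt => /negP; apply.
apply: lt_le_trans (bern _).
move: Kn; rewrite ltr_pdivrMr ?subr_gt0 // => Kn.
have : n%:R <= (2 ^ n)%:R :> R by rewrite ler_nat ltnW // ltn_expl.
by nra.
Qed.

(* Krein's argument: |G^m x|^2 = <G^(2m) x, x> makes |G x| / |x| grow, along
   m = 2^n, at most like the m-th root of |G^m x|. *)
Lemma symmetric_growth_bounded G g x : 0 < g -> adjoint_pair G G ->
  (exists K, forall n, N (iter n G x) <= K * g ^+ n) -> N (G x) <= g * N x.
Proof.
move=> g0 GG [K GK].
have sq n : N (iter n G x) ^+ 2 <= N (iter (n + n) G x) * N x.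
  rewrite seminorm_sqr // -(adjoint_pair_iter n GG) -iterD.
  exact: Re_si_le.
have [x0|x0] := eqVneq (N x) 0.
  by have := sq 1%N; rewrite x0 !mulr0 /= real_exprn_even_le0 //= => /eqP ->.
have {}x0 : 0 < N x by rewrite lt_def x0 seminorm_ge0.
rewrite -ler_pdivrMr // -[leRHS]mul1r -ler_pdivrMr //.
apply: (@expr_bounded_le1 _ (K / N x)) => [|n].
  by rewrite !divr_ge0 ?seminorm_ge0 // ltW.
rewrite expr_div_n ler_pdivrMr ?exprn_gt0 //.
rewrite mulrAC; apply: le_trans (_ : N (iter (2 ^ n) G x) / N x <= _); last first.
  by rewrite ler_pM2r ?invr_gt0.
elim: n => [//|n IH].
rewrite expnS mulnC exprM.
apply: le_trans (_ : (N (iter (2 ^ n) G x) / N x) ^+ 2 <= _).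
  by rewrite ler_sqr ?nnegrE ?exprn_ge0 ?divr_ge0 ?seminorm_ge0.
rewrite muln2 -addnn expr_div_n ler_pdivrMr ?exprn_gt0 //.
rewrite expr2 mulrA divfK ?gt_eqF //; exact: sq.
Qed.

(** The composite [W \o T] is symmetric, so Krein's bound applies to it, and N (T x) ^ 2 = p (W (T
    x)) x <= g N x ^ 2. This is where the square root of g comes from. *)
Lemma adjoint_growth_bounded T W g x : 0 < g -> adjoint_pair T W ->
  (exists K, forall n, N (iter n (W \o T) x) <= K * g ^+ n) ->
  N (T x) <= Num.sqrt g * N x.
Proof.
move=> g0 TW GK.
have GG : adjoint_pair (W \o T) (W \o T).
  by move=> y z /=; rewrite TW (adjoint_pairC _ _ TW).
have := symmetric_growth_bounded g0 GG GK => /= h.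
rewrite -ler_sqr ?nnegrE ?mulr_ge0 ?sqrtr_ge0 ?seminorm_ge0 //.
rewrite exprMn (sqr_sqrtr (ltW g0)) seminorm_sqr // -TW.
apply: le_trans (Re_si_le pP _ _) _.
by rewrite expr2 mulrA ler_wpM2r ?seminorm_ge0.
Qed.

Section TwoOperators.
Context (T S T' S' : V -> V).
Context (TT' : adjoint_pair T T') (SS' : adjoint_pair S S').
Let T2 := T' \o T.
Let S2 := S' \o S.

(** The right-hand side is N (U' (U x)) ^ 2, and N (U' (U x)) >= p (U' (U x)) x = N (U x) ^ 2 for a
    unit vector x. *)
Let quad U U' x : adjoint_pair U U' -> N x = 1 ->
  N (U x) ^+ 4 <= complex.Re (p (U' (U (U' (U x)))) x).
Proof.
move=> UU' x1; have -> : complex.Re (p (U' (U (U' (U x)))) x) = N (U' (U x)) ^+ 2.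
  by rewrite UU' (adjoint_pairC _ _ UU') -seminorm_sqr.
rewrite (exprM _ 2 2) ler_sqr ?nnegrE ?exprn_ge0 ?seminorm_ge0 //.
rewrite seminorm_sqr // -UU'; apply: le_trans (Re_si_le pP _ _) _.
by rewrite x1 mulr1.
Qed.

Lemma cross_quadratic_le x : N x = 1 ->
  complex.Re `|p (S' (T x)) x| ^+ 2 <= 1 / 2 * N (T2 (T2 x) + S2 (S2 x)).
Proof.
move=> x1; rewrite SS'.
have CS := si_CauchySchwarz pP (T x) (S x).
have h : complex.Re `|p (T x) (S x)| ^+ 2 <= N (T x) ^+ 2 * N (S x) ^+ 2.
  by rewrite -exprMn ler_sqr // nnegrE ?mulr_ge0 ?seminorm_ge0 ?Re_normc_ge0.
have hT := quad TT' x1; have hS := quad SS' x1.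
have : complex.Re (p (T2 (T2 x) + S2 (S2 x)) x) <= N (T2 (T2 x) + S2 (S2 x)).
  by apply: le_trans (Re_si_le pP _ _) _; rewrite x1 mulr1.
rewrite siDl // raddfD /= => hR.
apply: le_trans h _; move: hR hT hS.
rewrite !(exprM _ 2 2).
set a := N (T x) ^+ 2; set b := N (S x) ^+ 2.
have := sqr_ge0 (a - b); nra.
Qed.

End TwoOperators.
End SemiAdjoint.

(** * Orthogonal projection onto closed subspaces and the Riesz representation theorem *)

Section Hilbert.
Context {R : realType} {H : completeNormedModType R[i]}.
Context (dot : {dot H for Num.conj}) (hH : hilbert_norm dot).
Local Notation N := (seminorm dot).

Lemma hilbert_semi_inner : semi_inner dot.
Proof.
split=> [a x y z|x y|x].
- by rewrite linearDl linearZl_LR.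
- by rewrite hermC expr0 mul1r.
- by rewrite -hH exprn_ge0.
Qed.
Let dotP := hilbert_semi_inner.

Lemma hilbert_normE x : `|x| = (N x)%:C.
Proof.
apply/eqP; rewrite -(@eqrXn2 _ 2) ?ler0c ?seminorm_ge0 // hH siE //.
by rewrite rmorphXn.
Qed.

(** By the parallelogram law the left-hand side is at most 4 (d + e) ^ 2 - 4 d ^ 2 = 8 d e + 4 e ^
    2, and e ^ 2 <= e. *)
Lemma minimizing_close (d e : R) (u v : H) : 0 <= d -> 0 <= e -> e <= 1 ->
  N u <= d + e -> N v <= d + e -> d <= N (2^-1%:C *: (u + v)) ->
  N (u - v) ^+ 2 <= (8 * d + 4) * e.
Proof.
move=> d0 e0 e1 ud vd duv.
have {}duv : d ^+ 2 * 4 <= N (u + v) ^+ 2.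
  have -> : N (u + v) = 2 * N (2^-1%:C *: (u + v)).
    by rewrite (seminormZ dotP) ?invr_ge0 // mulrA divff ?mul1r.
  by rewrite exprMn; have := seminorm_ge0 dot (2^-1%:C *: (u + v)); nra.
have := parallelogram dotP u v.
have u0 := seminorm_ge0 dot u; have v0 := seminorm_ge0 dot v.
have {}ud : N u ^+ 2 <= (d + e) ^+ 2 by rewrite ler_sqr // nnegrE addr_ge0.
have {}vd : N v ^+ 2 <= (d + e) ^+ 2 by rewrite ler_sqr // nnegrE addr_ge0.
by nra.
Qed.

(** A sequence in M minimizing the distance to x is Cauchy by [minimizing_close]. Its limit is a
    nearest point m of M, and minimality makes x - m orthogonal to M. *)
Lemma orthogonal_projection (M : set H) (x : H) : closed M -> M 0 ->
  (forall a y z, M y -> M z -> M (a *: y + z)) ->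
  exists2 m, M m & orthocompl dot M (x - m).
Proof.
move=> Mcl M0 Mlin.
have MZ a y : M y -> M (a *: y) by move=> My; have := Mlin a y 0 My M0; rewrite addr0.
pose E := [set N (x - y) | y in M].
have Elb : has_lbound E by exists 0 => _ [y _ <-]; exact: seminorm_ge0.
have E0 : E !=set0 by exists (N (x - 0)), 0.
set d := inf E.
have d0 : 0 <= d by apply: lb_le_inf => // _ [y _ <-]; exact: seminorm_ge0.
have dle y : M y -> d <= N (x - y) by move=> My; apply: ge_inf => //; exists y.
have /choice[u uP] (n : nat) : exists y, M y /\ N (x - y) < d + n.+1%:R^-1.
  have [|_ [y My <-] yd] := @inf_adherent _ E n.+1%:R^-1 _ (conj E0 Elb).
    by rewrite invr_gt0.
  by exists y.
have uM n : M (u n) by case: (uP n).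
have uclose n k : (n <= k)%N -> N (u n - u k) ^+ 2 <= (8 * d + 4) * n.+1%:R^-1.
  move=> nk; have kn : k.+1%:R^-1 <= n.+1%:R^-1 :> R.
    by rewrite lef_pV2 ?posrE // ler_nat.
  have -> : u n - u k = (x - u k) - (x - u n) by rewrite opprB [RHS]addrC subrKA.
  apply: minimizing_close => //.
  - by rewrite invf_le1 // ler1n.
  - by apply: le_trans (ltW (proj2 (uP k))) _; rewrite lerD2l.
  - exact: ltW (proj2 (uP n)).
  (* The midpoint of [u k] and [u n] lies in M, hence at distance at least d from x. *)
  - have -> : 2^-1%:C *: (x - u k + (x - u n)) = x - 2^-1%:C *: (u k + u n).
      rewrite addrACA -opprD scalerBr; congr (_ - _).
      rewrite scalerDr -scalerDl -rmorphD /= (_ : 2^-1 + 2^-1 = 1) ?scale1r //.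
      by field.
    by apply: dle; apply/MZ; have := Mlin 1 _ _ (uM k) (uM n); rewrite scale1r.
have uc : cvg (u @ \oo).
  apply: cauchy_cvg; apply: cauchy_exP => eps eps0.
  have epsE : eps = (complex.Re eps)%:C by rewrite RRe_real // gtr0_real.
  set e := complex.Re eps in epsE; rewrite epsE in eps0 *; move: eps0; rewrite ltcR => eps0.
  (* Chosen so that 1 / (n + 1) < e2 makes the bound in [uclose] smaller than e ^ 2. *)
  pose e2 := e ^+ 2 / (8 * d + 4).
  have q0 : 0 < 8 * d + 4 by lra.
  have e20 : 0 < e2 by rewrite divr_gt0 // exprn_gt0.
  have [n _ nP] := near_infty_natSinv_lt (PosNum e20).
  exists (u n); exists n => // k /= nk.
  rewrite -ball_normE /= hilbert_normE ltcR -ltr_sqr ?nnegrE ?seminorm_ge0 ?(ltW eps0) //.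
  apply: le_lt_trans (uclose n k nk) _.
  by rewrite mulrC -ltr_pdivlMr //; apply: nP => /=.
have [m um] := (cvg_ex _).1 uc.
have Mm : M m by apply: (closed_cvg _ Mcl _ m um); exists 0%N => // n _; exact: uM.
exists m => // y My; apply: (seminorm_min_ortho dotP) => a.
have -> : x - m - a *: y = x - (a *: y + m) by rewrite opprD addrA addrAC.
apply: le_trans (dle _ (Mlin _ _ _ My Mm)).
(* It remains to see that m attains the infimum: half of e pays for the excess of N (x - u n) over
   d, the other half for N (u n - m). *)
apply/ler_addgt0Pr => e e0.
have e40 : 0 < e / 2 by rewrite divr_gt0.
have [n1 _ n1P] := near_infty_natSinv_lt (PosNum e40).
have e4c : 0 < (e / 2)%:C :> R[i] by rewrite ltcR.
have [n2 _ n2P] := (cvgrPdist_lt _ _).1 um _ e4c.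
pose n := maxn n1 n2.
have h1 := n1P n (leq_maxl _ _); have := n2P n (leq_maxr _ _).
rewrite /= hilbert_normE ltcR (seminormBC dotP) => h2.
have -> : x - m = (x - u n) + (u n - m) by rewrite subrKA.
apply: le_trans (seminormD dotP _ _) _.
have sum_le (r s t q : R) : r < d + s -> s < q / 2 -> t < q / 2 -> r + t <= d + q.
  by lra.
exact: sum_le (proj2 (uP n)) h1 h2.
Qed.

(** If f x is nonzero, the ball around x of radius |f x| / (|c| + 1) misses the kernel; adding 1
    keeps the divisor positive. The target V is general so as to serve both functionals and the
    operator A. *)
Lemma closed_bounded_ker (V : normedZmodType R[i]) (f : H -> V) (c : R) :
  {morph f : x y / x - y} -> (forall x, `|f x| <= c%:C * `|x|) ->
  closed [set x | f x = 0].
Proof.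
move=> fB fc x xcl; apply/eqP; rewrite -normr_eq0.
have fxR : `|f x| = (complex.Re `|f x|)%:C by rewrite RRe_real // normr_real.
rewrite fxR; apply/eqP; congr (_%:C); apply/eqP.
have -> : complex.Re `|f x| == 0 = (complex.Re `|f x| <= 0).
  by rewrite eq_le -(ler0c (complex.Re _)) -fxR normr_ge0 andbT.
rewrite leNgt; apply/negP => f0.
have c1 : 0 < `|c| + 1 by apply: ltr_wpDl.
have e0 : 0 < complex.Re `|f x| / (`|c| + 1) by rewrite divr_gt0.
have [|y [fy]] := xcl (ball x (complex.Re `|f x| / (`|c| + 1))%:C).
  by apply: nbhsx_ballx; rewrite ltcR.
rewrite -ball_normE /= hilbert_normE ltcR ltr_pdivlMr // => xy.
have := fc (x - y); rewrite fB fy subr0 hilbert_normE {1}fxR -rmorphM lecR.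
have := seminorm_ge0 dot (x - y); have := ler_norm c; nra.
Qed.

Lemma riesz (f : H -> R[i]) (c : R) :
  (forall a x y, f (a *: x + y) = a * f x + f y) ->
  (forall x, `|f x| <= c%:C * `|x|) -> exists z, forall x, f x = dot x z.
Proof.
move=> flin fc.
have f0 : f 0 = 0.
  have := flin 1 0 0; rewrite scaler0 addr0 mul1r => /esym/eqP.
  by rewrite -subr_eq0 addrK => /eqP.
have fB : {morph f : x y / x - y}.
  move=> x y; have := flin (-1) y x.
  by rewrite scaleN1r mulN1r addrC => ->; rewrite addrC.
have fZ a x : f (a *: x) = a * f x by have := flin a x 0; rewrite addr0 f0 addr0.
have [fz|/existsNP [u fu]] := pselect (forall x, f x = 0).
  by exists 0 => x; rewrite fz linear0r.
have [a y z /= fy fz|m /= fm mperp] :=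
    orthogonal_projection u (closed_bounded_ker fB fc) f0.
  by rewrite flin fy fz mulr0 addr0.
set n := u - m in mperp.
have fn : f n != 0 by rewrite fB fm subr0; apply/eqP.
have nn : dot n n != 0.
  apply: contra_neq fn => /eqP; rewrite -hH sqrf_eq0 normr_eq0 => /eqP ->.
  exact: f0.
(* As n is orthogonal to the kernel, which contains x - (f x / f n) n, one has <x, n> = (f x / f n)
   <n, n>. This dictates the scalar, conjugated because [dot] is conjugate-linear on the right. *)
exists (Num.conj (f n / dot n n) *: n) => x.
have : dot n (x - (f x / f n) *: n) = 0.
  by apply: mperp => /=; rewrite fB fZ divfK // subrr.
rewrite (siDr dotP) (siNr dotP) => /eqP; rewrite subr_eq0 => /eqP nx.
have xn : dot x n = f x / f n * dot n n.
  have [_ C _] := dotP.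
  by rewrite C nx -C (siZl dotP).
rewrite (siZr dotP) xn conjCK; by field; rewrite fn nn.
Qed.

End Hilbert.

(** * The adjoint, the Moore-Penrose inverse and the A-boundedness of operators in [BA] *)

Section SemiHilbert.
Context {R : realType} {H : completeNormedModType R[i]}.
Context (dot : {dot H for Num.conj}) (hH : hilbert_norm dot).
Local Notation N := (seminorm dot).
Let dotP := hilbert_semi_inner hH.

(** Riesz, applied to the functional <T x, y> of x, shows that the set in [adjoint] is nonempty, so
    [xget] does not fall back on 0. *)
Lemma adjointP (T : {linear H -> H}) x y : bounded_op T ->
  dot (T x) y = dot x (adjoint dot T y).
Proof.
move=> [c Tc]; apply: (@xgetPex _ 0 [set z | forall x, dot (T x) y = dot x z]) x.
apply: (riesz hH (c := c * N y)) => [a u v|u].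
  by rewrite linearP linearDl linearZl_LR.
rewrite (hilbert_normE hH) -rmorphM normcE_Re lecR.
apply: le_trans (si_CauchySchwarz dotP _ _) _.
have := Tc u; rewrite !(hilbert_normE hH) -rmorphM lecR => Tu.
by rewrite mulrAC ler_wpM2r ?seminorm_ge0.
Qed.

Lemma bounded_opP (T : {linear H -> H}) : bounded_op T ->
  exists2 c : R, 0 < c & forall x, N (T x) <= c * N x.
Proof.
move=> [c Tc]; exists (`|c| + 1) => [|x]; first exact: ltr_wpDl.
have := Tc x; rewrite !(hilbert_normE hH) -rmorphM lecR => /le_trans; apply.
by rewrite ler_wpM2r ?seminorm_ge0 // ler_wpDr // ler_norm.
Qed.

Context (A : {linear H -> H}) (Abd : bounded_op A) (Apos : positive_op dot A).

(** Removing from x its projection onto the kernel of A gives a point of the set in [mpinv]. For the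
    value w chosen there, A x - A w is both in the range of A and orthogonal to it, hence 0. *)
Lemma mpinvK x : A (mpinv dot A (A x)) = A x.
Proof.
have [c Ac] := Abd.
have [a y z /= Ay Az|m /= Am mperp] :=
    orthogonal_projection hH x (closed_bounded_ker hH (raddfB A) Ac) (raddf0 A).
  by rewrite linearP Ay Az scaler0 addr0.
have [_ ran] : [set z | orthocompl dot [set z | A z = 0] z /\
    orthocompl dot (range A) (A x - A z)] (mpinv dot A (A x)).
  apply: xgetPex; exists (x - m); split=> //.
  by rewrite linearB /= Am subr0 subrr => y _; rewrite linear0l.
set w := mpinv _ _ _ in ran *.
have : dot (A x - A w) (A x - A w) = 0.
  by apply: ran; exists (x - w) => //; rewrite linearB.
by rewrite -hH => /eqP; rewrite sqrf_eq0 normr_eq0 subr_eq0 => /eqP.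
Qed.

(* Polarization: over the complex field a positive operator is symmetric. *)
Lemma dotA_semi_inner : semi_inner (dotA dot A).
Proof.
split=> [a x y z|x y|//]; rewrite /dotA.
  by rewrite linearP linearDl linearZl_LR.
have Im0 z := ger0_Im (Apos z).
have h1 := Im0 (x + y); have h2 := Im0 (x + 'i%C *: y).
have AZ a z : A (a *: z) = a *: A z by rewrite linearZ.
move: h1 h2; rewrite !(linearD A) !AZ !(siDl dotP) !(siDr dotP).
rewrite !(siZl dotP) !(siZr dotP).
have := Im0 x; have := Im0 y.
case: (dot (A x) x) => ? ?; case: (dot (A y) y) => ? ?.
case: (dot (A x) y) => a b; case: (dot (A y) x) => c d /=.
move=> -> ->; rewrite !(mul0r, mul1r, mulr0, add0r, addr0, oppr0, sub0r, mulN1r, subr0, opprK).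
move=> h1 h2; apply/eqP; rewrite eq_complex /=; apply/andP; split; apply/eqP; lra.
Qed.

(** The operator W in [BA] places T^* A x in the range of A, where [mpinvK] applies; so A T^# = T^*
    A. *)
Lemma adjoint_pair_sharpA (T : {linear H -> H}) :
  BA dot A T -> adjoint_pair (dotA dot A) T (sharpA dot A T).
Proof.
move=> [Tbd [W _ AW]] x y; have [_ C _] := dotP.
rewrite /dotA /sharpA /= -AW mpinvK AW C -adjointP // -C //.
Qed.

(** Krein's argument with the pair T, W, both bounded in the Hilbert norm: the iterates of [W \o T]
    grow at most like (w t) ^ n there, hence also in the A-seminorm. *)
Lemma BA_bounded (T : {linear H -> H}) : BA dot A T ->
  exists2 c : R, 0 <= c & forall x, normA dot A (T x) <= c * normA dot A x.
Proof.
move=> BT; have AP := dotA_semi_inner.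
have [Tbd [W Wbd AW]] := BT.
have TW : adjoint_pair (dotA dot A) T W.
  by move=> x y; rewrite -(adjoint_pair_sharpA BT) /dotA /sharpA /= -AW mpinvK.
have [t t0 Tt] := bounded_opP Tbd; have [w w0 Ww] := bounded_opP Wbd.
have [a a0 Aa] := bounded_opP Abd.
have g0 : 0 < w * t by rewrite mulr_gt0.
exists (Num.sqrt (w * t)); first exact: sqrtr_ge0.
move=> x; apply: (adjoint_growth_bounded AP g0 TW).
(* The factor sqrt a compares the two seminorms: <A y, y> <= a N y ^ 2. *)
exists (Num.sqrt a * N x) => n; set y := iter _ _ _.
have yn : N y <= (w * t) ^+ n * N x.
  rewrite /y; elim: n {y} => [|n IH]; first by rewrite mul1r.
  rewrite iterS /= exprS -mulrA; apply: le_trans (Ww _) _; rewrite -!mulrA.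
  rewrite ler_pM2l //; apply: le_trans (Tt _) _.
  by rewrite ler_pM2l.
rewrite mulrAC -mulrA; apply: le_trans (_ : Num.sqrt a * N y <= _); last first.
  by rewrite ler_wpM2l // sqrtr_ge0.
rewrite -ler_sqr ?nnegrE ?mulr_ge0 ?seminorm_ge0 ?sqrtr_ge0 //.
rewrite exprMn (sqr_sqrtr (ltW a0)) (seminorm_sqr AP).
apply: le_trans (Re_si_le dotP _ _) _.
by rewrite expr2 mulrA ler_wpM2r ?seminorm_ge0.
Qed.

End SemiHilbert.

(** * Suprema of sets of reals, and the two inequalities *)

Lemma sup_ge0 (R : realType) (E : set R) :
  (forall x, E x -> 0 <= x) -> 0 <= sup E.
Proof.
move=> E0; have [[[x Ex] Eub]|/sup_out -> //] := pselect (has_sup E).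
exact: le_trans (E0 x Ex) (ub_le_sup Eub Ex).
Qed.

(** The sign of c settles the empty set, which occurs when A = 0. *)
Lemma ge_sup_ge0 (R : realType) (E : set R) (c : R) :
  0 <= c -> ubound E c -> sup E <= c.
Proof.
move=> c0 Ec; have [->|/set0P E0] := eqVneq E set0; first by rewrite sup0.
exact: ge_sup.
Qed.

Theorem corollary3p29 (R : realType) (H : completeNormedModType R[i])
    (dot : {dot H for Num.conj}) (hH : hilbert_norm dot)
    (hnontriv : exists x : H, x <> 0)
    (A : {linear H -> H}) (hAbd : bounded_op A) (hApos : positive_op dot A)
    (T S : {linear H -> H}) (hT : BA dot A T) (hS : BA dot A S) :
  let T2 := sharpA dot A T \o T in
  let S2 := sharpA dot A S \o S in
  let ST := sharpA dot A S \o T in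
  let N := opnormA dot A ((T2 \o T2) \+ (S2 \o S2)) in
  let bound := inf [set r : R | exists alpha beta : R,
    [/\ 0 <= alpha, 0 <= beta, (alpha, beta) <> (0, 0) &
        r = 1 / (alpha + beta) *
            (alpha / 2 * N + beta * opnormA dot A ST ^+ 2)]] in
  numradA dot A ST ^+ 2 <= bound /\ bound <= 1 / 2 * N.
Proof.
move=> T2 S2 ST N bound.
have AP := dotA_semi_inner hH hApos.
have TT := adjoint_pair_sharpA hH hAbd hT.
have SS := adjoint_pair_sharpA hH hAbd hS.
have [t t0 Tt] := BA_bounded hH hAbd hApos hT.
have [s s0 Ss] := BA_bounded hH hAbd hApos hS.
have T't := adjoint_pair_bounded AP t0 TT Tt.
have S's := adjoint_pair_bounded AP s0 SS Ss.
have nA0 x : 0 <= normA dot A x by exact: seminorm_ge0.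
have T2t x : normA dot A (T2 x) <= t ^+ 2 * normA dot A x.
  by rewrite expr2 -mulrA; exact: le_trans (T't _) (ler_wpM2l t0 (Tt _)).
have S2s x : normA dot A (S2 x) <= s ^+ 2 * normA dot A x.
  by rewrite expr2 -mulrA; exact: le_trans (S's _) (ler_wpM2l s0 (Ss _)).
(* The constant c only certifies that the set of values is bounded, so that its [sup] is an upper
   bound. *)
have le_opnormA (U : H -> H) (c : R) x :
    (forall y, normA dot A (U y) <= c * normA dot A y) ->
    normA dot A x = 1 -> normA dot A (U x) <= opnormA dot A U.
  move=> Uc x1; apply: ub_le_sup; last by exists x.
  exists c => _ [y /= y1 <-]; rewrite -[leRHS]mulr1 -y1; exact: Uc.
have opnormA_ge0 U : 0 <= opnormA dot A U.
  by apply: sup_ge0 => _ [y _ <-].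
have xN x : normA dot A x = 1 ->
    complex.Re `|dotA dot A (ST x) x| ^+ 2 <= 1 / 2 * N.
  move=> x1; apply: le_trans (cross_quadratic_le AP TT SS x1) _.
  rewrite ler_pM2l //.
  apply: (le_opnormA ((T2 \o T2) \+ (S2 \o S2))
    (t ^+ 2 * t ^+ 2 + s ^+ 2 * s ^+ 2)) => // y.
  apply: le_trans (seminormD AP _ _) _; rewrite mulrDl -(mulrA (t ^+ 2)) -(mulrA (s ^+ 2)).
  apply: lerD; first exact: le_trans (T2t _) (ler_wpM2l (sqr_ge0 t) (T2t _)).
  exact: le_trans (S2s _) (ler_wpM2l (sqr_ge0 s) (S2s _)).
have xST x : normA dot A x = 1 ->
    complex.Re `|dotA dot A (ST x) x| <= opnormA dot A ST.
  move=> x1; apply: le_trans (si_unit_le AP _ x1) _.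
  apply: (le_opnormA ST (s * t)) => // y.
  by rewrite -mulrA; exact: le_trans (S's _) (ler_wpM2l s0 (Tt _)).
have N0 : 0 <= N := opnormA_ge0 _.
have numrad_ge0 : 0 <= numradA dot A ST.
  by apply: sup_ge0 => _ [y _ <-]; exact: Re_normc_ge0.
have numrad_le c : 0 <= c -> (forall x, normA dot A x = 1 ->
    complex.Re `|dotA dot A (ST x) x| <= c) -> numradA dot A ST <= c.
  by move=> c0 xc; apply: ge_sup_ge0 => // _ [y y1 <-]; exact: xc.
have numN : numradA dot A ST ^+ 2 <= 1 / 2 * N.
  have N20 : 0 <= 1 / 2 * N by rewrite mulr_ge0.
  (* Passing to square roots turns the claim into a bound on the supremum itself, to be checked at
     each unit vector. *)
  rewrite -[leRHS]sqr_sqrtr // ler_sqr ?nnegrE ?sqrtr_ge0 //.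
  apply: numrad_le => [|x x1]; first exact: sqrtr_ge0.
  rewrite -ler_sqr ?nnegrE ?sqrtr_ge0 ?Re_normc_ge0 // sqr_sqrtr //; exact: xN.
have numST : numradA dot A ST ^+ 2 <= opnormA dot A ST ^+ 2.
  by rewrite ler_sqr ?nnegrE //; exact: numrad_le.
rewrite {}/bound; set B := [set r | _].
have memB : B (1 / 2 * N).
  exists 1, 0; split=> //; last by rewrite addr0 divr1 mul0r addr0 [RHS]mul1r.
  by case=> /eqP; rewrite oner_eq0.
have lbB : lbound B (numradA dot A ST ^+ 2).
  move=> _ [a [b [a0 b0 ab ->]]].
  have ab0 : 0 < a + b.
    rewrite lt_def addr_ge0 // andbT; apply/eqP => ab_eq0; apply: ab.
    by congr (_, _); lra.
  by rewrite mulrAC mul1r ler_pdivlMr //; nra.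
split; first exact: lb_le_inf (ex_intro _ _ memB) lbB.
exact: ge_inf (ex_intro _ _ lbB) _ memB.
Qed.
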